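(* Let $V$ be a positive-dimensional vector space over an algebraically closed field, let $G=GL(V)$, and let $e\geq1$. The set of tuples $(g_1,\dots,g_e)\in G^e$ such that $\langle g_1,\dots,g_e\rangle$ acts primitively on $V$ is a Zariski open subset of $G^e$.
   Context: A group acts primitively on $V$ if it acts irreducibly and preserves no decomposition $V=V_1\oplus\dots\oplus V_t$ with $t>1$ into nonzero subspaces that it permutes. *)

(* Defs.v *)
From HB Require Import structures.
From mathcomp Require Import all_boot all_order all_algebra all_fingroup.
From mathcomp Require Import mpoly.
Set Implicit Arguments. Unset Strict Implicit. Unset Printing Implicit Defensive.
Import GRing.Theory.
Local Open Scope ring_scope.

(* V = F^n as row vectors 'rV[F]_n; subspaces of V are row spaces of
   matrices in 'M[F]_n (mxalgebra); GL(V) = invertible n x n matrices acting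
   on the right (v |-> v *m g). A tuple in G^e is gs : 'I_e -> 'M[F]_n. *)

Section Defs.
Variables (F : fieldType) (n e : nat).

Definition GLtuple (gs : 'I_e -> 'M[F]_n) : Prop :=
  forall i, gs i \in unitmx.

Inductive gen_group (gs : 'I_e -> 'M[F]_n) : 'M[F]_n -> Prop :=
| gen_one : gen_group gs 1%:M
| gen_gen i : gen_group gs (gs i)
| gen_inv i : gen_group gs (invmx (gs i))
| gen_mul a b : gen_group gs a -> gen_group gs b -> gen_group gs (a *m b).

Definition acts_irreducibly (H : 'M[F]_n -> Prop) : Prop :=
  (0 < n)%N /\
  forall U : 'M[F]_n, (forall h, H h -> (U *m h <= U)%MS) ->
    U = 0 \/ row_full U.

Definition preserves_decomposition (H : 'M[F]_n -> Prop) : Prop :=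
  exists (t : nat) (Vs : 'I_t -> 'M[F]_n),
    [/\ (1 < t)%N,
        forall i, Vs i != 0,
        mxdirect (\sum_(i < t) Vs i),
        row_full (\sum_(i < t) Vs i)%MS &
        forall h, H h -> exists s : {perm 'I_t},
          forall i, (Vs i *m h == Vs (s i))%MS].

Definition acts_primitively (H : 'M[F]_n -> Prop) : Prop :=
  acts_irreducibly H /\ ~ preserves_decomposition H.

Definition tuple_coords (gs : 'I_e -> 'M[F]_n) : 'I_(e * (n * n)) -> F :=
  fun k => mxvec (\matrix_(i < e, j < n * n) mxvec (gs i) 0 j) 0 k.

(* S is a Zariski open subset of G^e (subspace topology from the affine
   space M_n(F)^e = A^(e n^2)): S is contained in G^e and its complement in
   G^e is the common zero locus in G^e of some set of polynomials *)
Definition zariski_open_in_GLtuple (S : ('I_e -> 'M[F]_n) -> Prop) : Prop :=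
  (forall gs, S gs -> GLtuple gs) /\
  exists P : {mpoly F[e * (n * n)]} -> Prop,
    forall gs, GLtuple gs ->
      (~ S gs <-> forall p, P p -> p.@[tuple_coords gs] = 0).

End Defs.

(* Main.v *)
(* A tuple fails to be primitive iff, for some action of the free monoid on a set
   of t blocks (finitely many, since t <= n), the words fixing a given block leave
   invariant a nonzero subspace W of dimension at most d, where d = n/t if t > 1
   and d = n - 1 if t = 1. For an algebra A of matrices, such a W exists iff some
   nonzero vector v is killed by all a * C with a in A and C a value on A of the
   Capelli polynomial
     sum_s sgn(s) prod_(i < d^2 + 1) y_i x_(s i) y'_i,
   which is an identity of k x k matrices exactly when k <= d: values kill W, and
   conversely the vectors they kill form a submodule whose simple submodules have
   dimension at most d by Burnside's theorem. As "vC = 0 for all C" is linear in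
   v, a nonzero solution exists iff all n x n minors built from columns of the C
   vanish. These minors are polynomials in the entries of the generators. *)
Require Import Defs.
From HB Require Import structures.
From mathcomp Require Import all_boot all_order all_algebra all_fingroup.
From mathcomp Require Import mpoly.
From Stdlib Require Import Classical_Prop.
Set Implicit Arguments. Unset Strict Implicit. Unset Printing Implicit Defensive.
Import GRing.Theory.
Local Open Scope ring_scope.

(** * Linear algebra: spanning families and minors *)

Section LinearAlgebra.
Variable F : fieldType.

(** Vectors satisfying [Pr] are appended as long as one lies outside the row space; each raises the
    rank, so this stops. *)
Lemma spanning_matrix n (Pr : 'rV[F]_n -> Prop) :
  exists k (M : 'M[F]_(k, n)),
    (forall i, Pr (row i M)) /\ forall u, Pr u -> (u <= M)%MS.
Proof.
suff H r k (M : 'M[F]_(k, n)) : (n - \rank M <= r)%N ->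
    (forall i, Pr (row i M)) -> exists k' (M' : 'M[F]_(k', n)),
    (forall i, Pr (row i M')) /\ forall u, Pr u -> (u <= M')%MS.
  by apply: (H n 0 0) => [|[]//]; rewrite leq_subr.
elim: r k M => [|r IHr] k M le_r PrM;
  have [spM|] := classic (forall u, Pr u -> (u <= M)%MS); try by exists k, M.
  case=> u _; apply: submx_full.
  by rewrite /row_full eqn_leq rank_leq_col -subn_eq0 -leqn0.
move=> nspM; have [u [Pru nuM]] : exists u, Pr u /\ ~~ (u <= M)%MS.
  apply: NNPP => nex; apply: nspM => u Pru; apply/negP => /negP nuM.
  by apply: nex; exists u.
have ltM : (M < M + u)%MS.
  rewrite ltmxE addsmxSl /=; apply: contra nuM.
  by apply: submx_trans (addsmxSr M u).
apply: (IHr _ (col_mx M u)) => [|i].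
  rewrite !leq_subLR in le_r *; apply: (leq_trans le_r).
  by rewrite addnS -addSn leq_add2r -addsmxE rank_ltmx.
rewrite -[i]splitK; case: (split i) => j /=.
  by rewrite rowKu.
by rewrite rowKd row_id.
Qed.

(** If no nonzero [v] is killed by all these [C], their columns span the whole space, and [n] of
    them, possibly from different [C], form a basis. *)
Lemma nonzero_minor n (Pr : 'M[F]_n -> Prop) :
    (forall v : 'rV_n, (forall C, Pr C -> v *m C = 0) -> v = 0) ->
  exists (C : 'I_n -> 'M[F]_n) (c : 'I_n -> 'I_n),
    (forall i, Pr (C i)) /\ \det (\matrix_(i, j) C i j (c i)) != 0.
Proof.
move=> noker; pose Q (u : 'rV[F]_n) := exists (Cc : 'M[F]_n * 'I_n),
  Pr Cc.1 /\ u = row Cc.2 Cc.1^T.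
have [k [M [QM spM]]] := spanning_matrix Q.
(* Transposed, each column of the cokernel of [M] is killed by every [C], hence zero. *)
have fullM : row_full M.
  rewrite -cokermx_eq0; apply/eqP/trmx_inj; rewrite trmx0.
  apply/row_matrixP => i; rewrite row0; apply: noker => C PrC.
  suff C0 : C^T *m cokermx M = 0.
    by rewrite -row_mul -[_ *m C]trmxK trmx_mul trmxK C0 trmx0 row0.
  apply/row_matrixP => j; rewrite row_mul row0.
  have /submxP [D ->] : (row j C^T <= M)%MS by apply: spM; exists (C, j).
  by rewrite -mulmxA mulmx_coker mulmx0.
have := fullrowsub_unit fullM; rewrite unitmxE unitfE.
have /fin_all_exists [Cc Cc_P] : forall i, exists Cc : 'M[F]_n * 'I_n,
  Pr Cc.1 /\ row (fullrankfun fullM i) M = row Cc.2 Cc.1^T by move=> i; apply: QM.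
move=> detN0; exists (fun i => (Cc i).1), (fun i => (Cc i).2); split.
  by move=> i; case: (Cc_P i).
congr (\det _ != 0): detN0; apply/matrixP => i j.
have [_ /rowP /(_ j)] := Cc_P i; by rewrite !mxE.
Qed.

Lemma linear_pred_submx k n (Pr : 'rV[F]_n -> Prop) (M : 'M[F]_(k, n)) u :
    Pr 0 -> (forall a b, Pr a -> Pr b -> Pr (a + b)) ->
    (forall c a, Pr a -> Pr (c *: a)) ->
  (forall i, Pr (row i M)) -> (u <= M)%MS -> Pr u.
Proof.
move=> Pr0 PrD PrZ PrM /submxP [D ->]; rewrite mulmx_sum_row.
by elim/big_ind: _ => // i _; apply: PrZ.
Qed.

End LinearAlgebra.

(* Burnside's theorem, in the style of Lomonosov and Rosenthal: an element of
   minimal nonzero rank must have rank one. *)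
Section Burnside.
Variables (F : closedFieldType) (k : nat) (A : 'M[F]_k -> Prop).
Hypothesis k_gt0 : (0 < k)%N.
Hypothesis A1 : A 1%:M.
Hypothesis AD : forall a b, A a -> A b -> A (a + b).
Hypothesis AZ : forall c a, A a -> A (c *: a).
Hypothesis AM : forall a b, A a -> A b -> A (a *m b).
Hypothesis irrA : forall U : 'M[F]_k, (forall a, A a -> (U *m a <= U)%MS) ->
  U = 0 \/ row_full U.

Let A0 : A 0. Proof. by rewrite -(scale0r 1%:M); apply: AZ. Qed.

Lemma irreducible_rect j (U : 'M[F]_(j, k)) :
  (forall a, A a -> (U *m a <= U)%MS) -> U = 0 \/ row_full U.
Proof.
move=> invU; case: (@irrA <<U>>%MS) => [a Aa|/eqP|].
- by rewrite (eqmxMr _ (genmxE U)) genmxE; apply: invU.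
- by rewrite -mxrank_eq0 genmxE mxrank_eq0 => /eqP; left.
- by rewrite /row_full genmxE; right.
Qed.

(** The images of [v] under [A] form a nonzero stable subspace. *)
Lemma irreducible_transitive (v u : 'rV[F]_k) :
  v != 0 -> exists2 a, A a & v *m a = u.
Proof.
move=> v0; pose Q w := exists2 a, A a & v *m a = w.
have [l [M [QM spM]]] := spanning_matrix Q.
have fullM : row_full M.
  have [a Aa|M0|//] := @irreducible_rect _ M.
    apply/row_subP => i; rewrite row_mul; have [b Ab <-] := QM i.
    by rewrite -mulmxA; apply: spM; exists (b *m a); first apply: AM.
  have: (v <= M)%MS by apply: spM; exists 1%:M; rewrite ?mulmx1.
  by rewrite M0 => /submx0null v_eq0; rewrite v_eq0 eqxx in v0.
apply: (@linear_pred_submx _ _ _ Q M) => //; last exact: submx_full.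
- by exists 0; rewrite ?mulmx0.
- move=> _ _ [a Aa <-] [b Ab <-].
  by exists (a + b); rewrite ?mulmxDr //; apply: AD.
- by move=> c _ [a Aa <-]; exists (c *: a); rewrite ?scalemxAr //; apply: AZ.
Qed.

(** Take independent rows [w1], [w2] of [T] and [S] in [A] with [w1 S T = w2]. On the row space of
    [T], [S T] has an eigenvalue [c]. Then [T (S T - c)] has smaller rank, as an eigenvector in that
    row space is killed, but is nonzero, as it has the row [w2 - c w1]. *)
Lemma irreducible_lower_rank (T : 'M[F]_k) : A T -> (1 < \rank T)%N ->
  exists T', [/\ A T', T' != 0 & (\rank T' < \rank T)%N].
Proof.
move=> AT rT.
have T0 : T != 0 by rewrite -mxrank_eq0 -lt0n ltnW.
have /row_subPn [i1] : ~~ (T <= (0 : 'M[F]_k)%R)%MS by rewrite submx0.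
rewrite submx0; set w1 := row i1 T => w10.
have /row_subPn [i2] : ~~ (T <= w1)%MS.
  apply: contraL rT => /mxrankS; rewrite rank_rV -leqNgt => /leq_trans-> //.
  by case: eqP.
set w2 := row i2 T => w2w1.
have [S AS w1S] := irreducible_transitive (delta_mx 0 i2) w10.
pose B := row_base T.
have BST : (B *m (S *m T) <= B)%MS.
  by rewrite mulmxA (submx_trans (submxMl _ _)) // eq_row_base.
have /submxP [N BN] := BST.
have /closed_rootP [c] : size (char_poly N) != 1%N.
  by rewrite size_char_poly eqSS -lt0n ltnW.
rewrite -eigenvalue_root_char => /eigenvalueP [u uN u0].
have uBT : (u *m B <= T)%MS by rewrite (submx_trans (submxMl _ _)) ?eq_row_base.
have uB0 : u *m B != 0.
  apply: contra u0 => /eqP; rewrite -[u in u == 0](mulmxKp (row_base_free T)).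
  by move=> ->; rewrite mul0mx.
pose Z := S *m T - c%:M.
have uBZ : u *m B *m Z = 0.
  by rewrite mulmxBr -mulmxA BN mulmxA uN mul_mx_scalar -scalemxAl subrr.
exists (T *m Z); split.
- rewrite mulmxBr mul_mx_scalar -scaleNr.
  by apply: AD; [apply: AM => //; apply: AM | apply: AZ].
- apply: contra w2w1 => /eqP TZ0.
  have : w1 *m Z = 0 by rewrite -row_mul TZ0 row0.
  rewrite mulmxBr mulmxA w1S -rowE mul_mx_scalar => /eqP; rewrite subr_eq0.
  by move=> /eqP eq21; rewrite /w2 eq21 scalemx_sub.
rewrite -(mxrank_mul_ker T Z) -[ltnLHS]addn0 ltn_add2l lt0n mxrank_eq0.
apply: contra uB0 => /eqP cap0; rewrite -submx0 -cap0 sub_capmx uBT.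
exact/sub_kermxP.
Qed.

Lemma irreducible_rank1 : exists T, A T /\ \rank T = 1%N.
Proof.
suff H r T : (\rank T <= r)%N -> A T -> T != 0 -> exists T', A T' /\ \rank T' = 1%N.
  apply: (H k 1%:M) => //; first exact: rank_leq_row.
  by rewrite -mxrank_eq0 mxrank1 -lt0n.
elim: r T => [|r IHr] T; first by rewrite leqn0 mxrank_eq0 => ->.
move=> rT AT T0; have [rT1|] := ltnP 1 (\rank T).
  have [T' [AT' T'0 ltT']] := irreducible_lower_rank AT rT1.
  by apply: IHr AT' T'0; rewrite -ltnS (leq_trans ltT').
move=> rT1; exists T; split=> //; apply/eqP.
by rewrite eqn_leq rT1 lt0n mxrank_eq0.
Qed.

(** From a rank-one [c *m r] in [A], right multiplication reaches every row in place of [r]. The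
    columns admissible in place of [c] form a nonzero subspace whose annihilator is stable under
    [A], hence zero. So all matrix units lie in [A]. *)
Theorem burnside (M : 'M[F]_k) : A M.
Proof.
have [T [AT rT]] := irreducible_rank1.
have [c [r [Tcr r0 c0]]] : exists (c : 'cV[F]_k) (r : 'rV[F]_k),
    [/\ T = c *m r, r != 0 & c != 0].
  move: (col_base T) (row_base T) (mulmx_base T); rewrite rT => c r Tcr.
  have T0 : T != 0 by rewrite -mxrank_eq0 rT.
  by exists c, r; split=> //; apply: contra T0 => /eqP E; rewrite -Tcr E ?mul0mx ?mulmx0.
pose D (d : 'rV[F]_k) := forall s : 'rV[F]_k, A (d^T *m s).
have Dc : D c^T.
  move=> s; have [a Aa <-] := irreducible_transitive s r0.
  by rewrite trmxK mulmxA -Tcr; apply: AM.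
have DD d : D d.
  have [l [N [DN spN]]] := spanning_matrix D.
  apply: (@linear_pred_submx _ _ _ D N) => //.
  - by move=> s; rewrite trmx0 mul0mx.
  - by move=> x y Dx Dy s; rewrite linearD mulmxDl; apply: AD.
  - by move=> b x Dx s; rewrite linearZ /= -scalemxAl; apply: AZ.
  suff ker0 : kermx N^T = 0.
    apply: submx_full; rewrite /row_full -mxrank_tr -[_ == k]/(row_free N^T).
    by rewrite -kermx_eq0 ker0.
  have [a Aa|//|fullK] := @irrA (kermx N^T).
    apply/sub_kermxP; apply/trmx_inj/row_matrixP => i; rewrite trmx0 row0.
    have /submxP [E aE] : (row i N *m a^T <= N)%MS.
      apply: spN => s; rewrite trmx_mul trmxK -mulmxA.
      by apply: AM => //; apply: DN.
    rewrite trmx_mul trmxK row_mul trmx_mul mulmxA aE -mulmxA.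
    by rewrite -{1}[N]trmxK -trmx_mul mulmx_ker trmx0 mulmx0.
  have := spN _ Dc; have : N^T = 0.
    rewrite row_full_unit in fullK.
    by rewrite -[LHS](mulKmx fullK) mulmx_ker mulmx0.
  move/(congr1 trmx); rewrite trmxK trmx0 => -> /submx0null ct0.
  by rewrite -[c]trmxK ct0 trmx0 eqxx in c0.
rewrite [M]matrix_sum_delta; elim/big_ind: _ => // i _.
elim/big_ind: _ => // j _; apply: AZ.
by have := DD (delta_mx 0 i) (delta_mx 0 j); rewrite trmx_delta mul_delta_mx.
Qed.

End Burnside.

(** * Capelli polynomials *)

Section Capelli.
Variable F : fieldType.

Definition capelli n m (y x y' : 'I_m -> 'M[F]_n) : 'M[F]_n :=
  \sum_(s : 'S_m) (-1) ^+ s *: \prod_(i < m) (y i *m x (s i) *m y' i).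

Lemma prod_scalemx n m (c : 'I_m -> F) (M : 'I_m -> 'M[F]_n) :
  \prod_(i < m) (c i *: M i) = \prod_(i < m) c i *: \prod_(i < m) M i.
Proof.
elim/big_rec3: _ => [|i a b M' _ ->]; first by rewrite scale1r.
by rewrite -[LHS]scalemxAl -[in LHS]scalemxAr scalerA.
Qed.

(** With [B] a basis of a stable subspace, restriction to that subspace thus commutes with
    evaluation. *)
Lemma capelli_intertwine k n m (B : 'M[F]_(k, n)) (y x y' : 'I_m -> 'M[F]_n)
    (z w z' : 'I_m -> 'M[F]_k) :
    (forall i, B *m y i = z i *m B) -> (forall i, B *m x i = w i *m B) ->
    (forall i, B *m y' i = z' i *m B) ->
  B *m capelli y x y' = capelli z w z' *m B.
Proof.
move=> Hy Hx Hy'; rewrite mulmx_sumr mulmx_suml; apply: eq_bigr => s _.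
rewrite -scalemxAr -scalemxAl; congr (_ *: _).
elim/big_rec2: _ => [|i M N _ BMN]; first by rewrite mulmx1 mul1mx.
rewrite -!mulmxE !mulmxA Hy -(mulmxA (z i) B) Hx !mulmxA -(mulmxA _ B) Hy'.
by rewrite -!mulmxA BMN !mulmxA.
Qed.

(* The value is multilinear and alternating in [x], so it vanishes as soon as
   the [x i] outnumber the dimension of the matrix algebra. *)
Lemma capelli_eq0 n m (y x y' : 'I_m -> 'M[F]_n) :
  (n * n < m)%N -> capelli y x y' = 0.
Proof.
move=> lt_m; pose J := ('I_n * 'I_n)%type.
pose E (p : J) : 'M[F]_n := delta_mx p.1 p.2.
(* Each [x j] is expanded in matrix units. The signed sum over [s] of products of coordinates is a
   determinant, with two equal rows because [f] repeats a value. *)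
transitivity (\sum_(f : {ffun 'I_m -> J})
    \det (\matrix_(i, j) x j (f i).1 (f i).2) *:
      \prod_(i < m) (y i *m E (f i) *m y' i)).
  under [RHS]eq_bigr => f _ do rewrite scaler_suml.
  rewrite exchange_big /=; apply: eq_bigr => s _.
  have Ex i : y i *m x (s i) *m y' i =
      \sum_(p : J) x (s i) p.1 p.2 *: (y i *m E p *m y' i).
    rewrite {1}[x (s i)]matrix_sum_delta pair_big mulmx_sumr mulmx_suml.
    by apply: eq_bigr => p _; rewrite -scalemxAr -scalemxAl.
  rewrite (eq_bigr _ (fun i _ => Ex i)) bigA_distr_bigA scaler_sumr.
  apply: eq_bigr => f _; rewrite prod_scalemx scalerA; congr (_ * _ *: _).
  by apply: eq_bigr => i _; rewrite mxE.
apply: big1 => f _; have /injectivePn [i [j ij fij]] : ~~ injectiveb f.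
  apply: contraL lt_m => /injectiveP /leq_card.
  by rewrite card_prod !card_ord leqNgt.
rewrite (determinant_alternate ij) ?scale0r // => l.
by rewrite !mxE fij.
Qed.

(** The outer factors make the [i]-th product vanish unless [s i = i], so only the identity
    permutation contributes. *)
Lemma capelli_delta n m (p q : 'I_m -> 'I_n) (r : 'I_n) :
    (0 < m)%N -> injective (fun i => (p i, q i)) ->
  capelli (fun i => delta_mx r (p i)) (fun i => delta_mx (p i) (q i))
          (fun i => delta_mx (q i) r) = delta_mx r r.
Proof.
move=> m_gt0 inj_pq.
have prodE l : \prod_(i < l.+1) (delta_mx r r : 'M[F]_n) = delta_mx r r.
  elim: l => [|l IHl]; first by rewrite big_ord1.
  by rewrite big_ord_recl IHl -mulmxE mul_delta_mx.
have termE (s : 'S_m) i : (delta_mx r (p i) : 'M[F]_n) *m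
    delta_mx (p (s i)) (q (s i)) *m delta_mx (q i) r
      = (s i == i)%:R *: delta_mx r r.
  rewrite mul_delta_mx_cond mulmxE mulrnAl -mulmxE mul_delta_mx_cond.
  rewrite -mulrnA mulnb scaler_nat.
  by rewrite -(inj_eq inj_pq) /= xpair_eqE andbC (eq_sym (p i)).
rewrite /capelli (bigD1 1%g) //= odd_perm1 scale1r.
rewrite (eq_bigr (fun _ => delta_mx r r)) => [|i _]; last first.
  by rewrite termE perm1 eqxx scale1r.
rewrite [X in X + _](_ : _ = delta_mx r r); last first.
  by rewrite -[RHS](prodE m.-1) prednK.
rewrite [X in _ + X]big1 ?addr0 // => s s1.
rewrite (eq_bigr _ (fun i _ => termE s i)) prod_scalemx.
have [i si] : exists i, s i != i.
  apply/existsP; rewrite -negb_forall; apply: contra s1 => /forallP s_id.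
  by apply/eqP/permP => i; rewrite perm1; apply/eqP.
by rewrite (bigD1 i) //= (negPf si) mul0r scale0r scaler0.
Qed.

End Capelli.

(** * Capelli values and submodules of small dimension *)

Section SmallSubmodule.
Variables (F : closedFieldType) (n : nat) (A : 'M[F]_n -> Prop).
Hypothesis A1 : A 1%:M.
Hypothesis AD : forall a b, A a -> A b -> A (a + b).
Hypothesis AZ : forall c a, A a -> A (c *: a).
Hypothesis AM : forall a b, A a -> A b -> A (a *m b).

Definition stable_by j (W : 'M[F]_(j, n)) : Prop :=
  forall a, A a -> (W *m a <= W)%MS.

Lemma exists_minimal_submodule (K : 'M[F]_n) : K != 0 -> stable_by K ->
  exists W : 'M[F]_n, [/\ (W <= K)%MS, W != 0, stable_by W &
    forall U : 'M[F]_n, U != 0 -> stable_by U -> (U <= W)%MS ->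
      (\rank W <= \rank U)%N].
Proof.
suff H r (W : 'M[F]_n) : (\rank W <= r)%N -> (W <= K)%MS -> W != 0 -> stable_by W ->
    exists W : 'M[F]_n, [/\ (W <= K)%MS, W != 0, stable_by W &
    forall U : 'M[F]_n, U != 0 -> stable_by U -> (U <= W)%MS ->
      (\rank W <= \rank U)%N].
  by move=> K0 invK; apply: (H n K _ (submx_refl K) K0 invK); apply: rank_leq_row.
elim: r W => [|r IHr] W rW WK W0 invW.
  by move: rW; rewrite leqn0 mxrank_eq0 (negPf W0).
have [minW|] := classic (forall U : 'M[F]_n, U != 0 -> stable_by U ->
  (U <= W)%MS -> (\rank W <= \rank U)%N); first by exists W.
move=> nmin; apply: NNPP => nex; apply: nmin => U U0 invU UW.
rewrite leqNgt; apply/negP => ltU; apply: nex; apply: (IHr U) => //.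
  by rewrite -ltnS (leq_trans ltU).
exact: submx_trans UW WK.
Qed.

Lemma row_base_action (W : 'M[F]_n) a : stable_by W -> A a ->
  exists M, row_base W *m a = M *m row_base W.
Proof.
move=> invW Aa; apply/submxP.
by rewrite (eqmxMr _ (eq_row_base W)) eq_row_base invW.
Qed.

(** Minimality makes the action on [W] irreducible, so Burnside's theorem applies to its matrices in
    the basis [row_base W]. *)
Lemma minimal_submodule_full (W : 'M[F]_n) (M : 'M[F]_(\rank W)) :
    W != 0 -> stable_by W ->
    (forall U : 'M[F]_n, U != 0 -> stable_by U -> (U <= W)%MS ->
      (\rank W <= \rank U)%N) ->
  exists2 a, A a & row_base W *m a = M *m row_base W.
Proof.
move=> W0 invW minW; pose B := row_base W.
have freeB : row_free B := row_base_free W.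
apply: (@burnside _ _ (fun M => exists2 a, A a & B *m a = M *m B)).
- by rewrite lt0n mxrank_eq0.
- by exists 1%:M; rewrite ?mulmx1 ?mul1mx.
- move=> N N' [a Aa BN] [a' Aa' BN']; exists (a + a'); first exact: AD.
  by rewrite mulmxDr mulmxDl BN BN'.
- move=> c N [a Aa BN]; exists (c *: a); first exact: AZ.
  by rewrite -scalemxAr -scalemxAl BN.
- move=> N N' [a Aa BN] [a' Aa' BN']; exists (a *m a'); first exact: AM.
  by rewrite mulmxA BN -(mulmxA N B) BN' mulmxA.
move=> U invU; have [->|U0] := eqVneq U 0; [by left | right].
rewrite /row_full eqn_leq rank_leq_row /= -(mxrankMfree U freeB).
rewrite -[\rank (U *m B)]mxrank_gen.
apply: minW; rewrite ?genmxE.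
- rewrite -mxrank_eq0 mxrank_gen mxrank_eq0.
  by apply: contra U0 => /eqP UB0; apply/eqP/(row_free_inj freeB); rewrite mul0mx.
- move=> a Aa; rewrite (eqmxMr _ (genmxE _)) genmxE.
  have [N BN] := row_base_action invW Aa.
  by rewrite -mulmxA BN mulmxA submxMr //; apply: invU; exists a.
- by rewrite (submx_trans (submxMl _ _)) ?eq_row_base.
Qed.

(* The vectors killed by all these values form a submodule; Burnside's theorem on
   a simple submodule of it of dimension greater than [d] would provide a value
   acting there as a matrix unit. *)
Lemma capelli_submodule d (v : 'rV[F]_n) : v != 0 ->
    (forall a (y x y' : 'I_(d * d).+1 -> 'M[F]_n), A a -> (forall i, A (y i)) ->
      (forall i, A (x i)) -> (forall i, A (y' i)) ->
      v *m (a *m capelli y x y') = 0) ->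
  exists W : 'M[F]_n, [/\ W != 0, (\rank W <= d)%N & stable_by W].
Proof.
pose Q (w : 'rV[F]_n) := forall a (y x y' : 'I_(d * d).+1 -> 'M[F]_n),
  A a -> (forall i, A (y i)) -> (forall i, A (x i)) -> (forall i, A (y' i)) ->
  w *m (a *m capelli y x y') = 0.
move=> v0 Qv; have [l [M [QM spM]]] := spanning_matrix Q.
have QMP w : (w <= M)%MS -> Q w.
  apply: (@linear_pred_submx _ _ _ Q M) => //.
  - by move=> *; rewrite mul0mx.
  - by move=> w1 w2 Q1 Q2 a y x y' *; rewrite mulmxDl Q1 ?Q2 ?addr0.
  - by move=> c w1 Q1 a y x y' *; rewrite -scalemxAl Q1 ?scaler0.
have K0 : (<<M>>)%MS != 0.
  apply: contra v0 => /eqP K0; rewrite -submx0 -K0 genmxE; exact: spM.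
(* The factor [a] in front of the Capelli values absorbs the action of [A]. *)
have invK : stable_by <<M>>%MS.
  move=> a Aa; rewrite (eqmxMr _ (genmxE M)) genmxE; apply/row_subP => i.
  rewrite row_mul; apply: spM => b y x y' Ab Ay Ax Ay'.
  by rewrite -mulmxA (mulmxA a) QM //; apply: AM.
have [W [WK W0 invW minW]] := exists_minimal_submodule K0 invK.
exists W; split=> //; rewrite leqNgt; apply/negP => lt_dW.
pose B := row_base W.
pose m := (d * d).+1; pose J := ('I_(\rank W) * 'I_(\rank W))%type.
(* Since [d < \rank W], there are at least [d * d + 1] distinct matrix units on [W]. *)
have le_m : (m <= #|{: J}|)%N.
  by rewrite card_prod card_ord; apply: ltn_mul.
pose f (i : 'I_m) : J := enum_val (widen_ord le_m i).
have inj_f : injective f.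
  by move=> i j /enum_val_inj /(congr1 val) /= /val_inj.
pose r : 'I_(\rank W) := Ordinal (leq_ltn_trans (leq0n d) lt_dW).
have lift (N : 'I_m -> 'M[F]_(\rank W)) : exists x : 'I_m -> 'M[F]_n,
    forall i, A (x i) /\ B *m x i = N i *m B.
  suff /fin_all_exists [x Px] i : exists a, A a /\ B *m a = N i *m B by exists x.
  by have [a Aa Ba] := minimal_submodule_full (N i) W0 invW minW; exists a.
have [y Py] := lift (fun i => delta_mx r (f i).1).
have [x Px] := lift (fun i => delta_mx (f i).1 (f i).2).
have [y' Py'] := lift (fun i => delta_mx (f i).2 r).
(* This value acts on [W] as [delta_mx r r], which does not kill row [r] of the basis. *)
have : row r B *m (1%:M *m capelli y x y') = 0.
  apply: QMP => //; try by move=> i; case: (Py i); case: (Px i); case: (Py' i).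
  by rewrite (submx_trans (row_sub _ _)) // eq_row_base (submx_trans WK) ?genmxE.
rewrite mul1mx -row_mul (capelli_intertwine (z := fun i => delta_mx r (f i).1)
  (w := fun i => delta_mx (f i).1 (f i).2) (z' := fun i => delta_mx (f i).2 r));
  try by move=> i; case: (Py i); case: (Px i); case: (Py' i).
rewrite capelli_delta //; last first.
  move=> i j /= [e1 e2]; apply: inj_f.
  by rewrite [LHS]surjective_pairing e1 e2 -surjective_pairing.
rewrite row_mul rowE mul_delta_mx => rB0.
have := row_free_inj (row_base_free W) (etrans rB0 (esym (mul0mx _ _))).
move/matrixP => /(_ 0 r); rewrite !mxE !eqxx => /eqP.
by rewrite oner_eq0.
Qed.

(** On [W] this is a Capelli value in matrices of size at most [d], with more than [d * d]
    alternating arguments. *)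
Lemma submodule_capelli d (W : 'M[F]_n) a (y x y' : 'I_(d * d).+1 -> 'M[F]_n) :
    stable_by W -> (\rank W <= d)%N -> A a -> (forall i, A (y i)) ->
    (forall i, A (x i)) -> (forall i, A (y' i)) ->
  W *m (a *m capelli y x y') = 0.
Proof.
move=> invW rW Aa Ay Ax Ay'; pose B := row_base W.
have lift (b : 'I_(d * d).+1 -> 'M[F]_n) : (forall i, A (b i)) ->
    exists M, forall i, B *m b i = M i *m B.
  move=> Ab; suff /fin_all_exists [M HM] i : exists N, B *m b i = N *m B by exists M.
  exact: row_base_action.
have [z Hz] := lift y Ay; have [w Hw] := lift x Ax.
have [z' Hz'] := lift y' Ay'; have [N HN] := row_base_action invW Aa.
have /submxP [D ->] : (W <= B)%MS by rewrite eq_row_base.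
rewrite -mulmxA [B *m _]mulmxA HN -(mulmxA N).
by rewrite (capelli_intertwine Hz Hw Hz') capelli_eq0 ?mul0mx ?mulmx0 // ltnS leq_mul.
Qed.

End SmallSubmodule.

(** * Words in the generators and blocks *)

Section Words.
Variables (F : fieldType) (n e : nat).
Implicit Types (gs : 'I_e -> 'M[F]_n) (w : seq 'I_e).

Definition word gs w : 'M[F]_n := foldr (fun i M => gs i *m M) 1%:M w.

Definition word_act t (sigma : 'I_e -> 'S_t) w (j : 'I_t) : 'I_t :=
  foldl (fun j i => sigma i j) j w.

(* [t] is one less than the number of blocks; for a single block we ask for an
   arbitrary proper subspace. *)
Definition block_dim (t : nat) : nat := (if t == 0 then n.-1 else n %/ t.+1)%N.

Definition has_block gs t (sigma : 'I_e -> 'S_t.+1) (b : 'I_t.+1) : Prop :=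
  exists W : 'M[F]_n, [/\ W != 0, (\rank W <= block_dim t)%N &
    forall w, word_act sigma w b = b -> (W *m word gs w <= W)%MS].

Lemma word_cat gs w1 w2 : word gs (w1 ++ w2) = word gs w1 *m word gs w2.
Proof. by elim: w1 => [|i w IHw] /=; rewrite ?mul1mx // IHw mulmxA. Qed.

Lemma word_unit gs w : GLtuple gs -> word gs w \in unitmx.
Proof.
by move=> gsU; elim: w => [|i w IHw] /=; rewrite ?unitmx1 // unitmx_mul gsU.
Qed.

Lemma word_act_cat t (sigma : 'I_e -> 'S_t) w1 w2 j :
  word_act sigma (w1 ++ w2) j = word_act sigma w2 (word_act sigma w1 j).
Proof. exact: foldl_cat. Qed.

(** Words have no inverse letters, but a permutation of a finite set is inverted by one of its
    powers. *)
Lemma word_act_return t (sigma : 'I_e -> 'S_t) w j :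
  exists w', word_act sigma w' (word_act sigma w j) = j.
Proof.
have inj_w : injective (word_act sigma w).
  by elim: w => [|i w IHw] j1 j2 //= /IHw /perm_inj.
suff iterE l : exists w', forall i, word_act sigma w' i = iter l (word_act sigma w) i.
  have [w' Hw'] := iterE (fingraph.order (word_act sigma w) (word_act sigma w j)).-1.
  by exists w'; rewrite Hw'; apply: (finv_f inj_w).
elim: l => [|l [w' IHl]]; first by exists [::].
by exists (w' ++ w) => i; rewrite word_act_cat IHl.
Qed.

Lemma submx_unit_eqmx (U W g : 'M[F]_n) :
  g \in unitmx -> \rank U = \rank W -> (U *m g <= W)%MS -> (U *m g == W)%MS.
Proof.
move=> gU rUW UgW; rewrite -(geq_leqif (mxrank_leqif_eq UgW)).
by rewrite mxrankMfree ?row_free_unit // rUW.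
Qed.

(** An invertible matrix mapping [U] into itself maps it onto itself, so its inverse preserves [U]
    too. *)
Lemma gen_group_invariant gs (U : 'M[F]_n) : GLtuple gs ->
    (forall i, (U *m gs i <= U)%MS) ->
  forall h, gen_group gs h -> (U *m h <= U)%MS.
Proof.
move=> gsU invU h; elim=> [|i|i|a b _ IHa _ IHb].
- by rewrite mulmx1.
- exact: invU.
- have /eqmxP eqU := submx_unit_eqmx (gsU i) erefl (invU i).
  by rewrite -{1}(eqmxMr _ eqU) ?mulmxK // -(eqmxMr _ eqU) mulmxK.
- by rewrite mulmxA (submx_trans (submxMr b IHa)).
Qed.

Lemma gen_group_permutes gs t (Vs : 'I_t -> 'M[F]_n) (sigma : 'I_e -> 'S_t) :
    GLtuple gs -> (forall i j, (Vs j *m gs i == Vs (sigma i j))%MS) ->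
  forall h, gen_group gs h ->
    exists s : 'S_t, forall j, (Vs j *m h == Vs (s j))%MS.
Proof.
move=> gsU permV h; elim=> [|i|i|a b _ [s Hs] _ [s' Hs']].
- by exists 1%g => j; rewrite perm1 mulmx1; apply/eqmxP.
- by exists (sigma i).
- exists (sigma i)^-1%g => j; apply/eqmxP/eqmx_sym.
  rewrite -{2}(permKV (sigma i) j).
  have /eqmxP VE := permV i ((sigma i)^-1%g j).
  apply: eqmx_sym; apply: (eqmx_trans (eqmxMr _ (eqmx_sym VE))).
  by rewrite mulmxK.
- exists (s * s')%g => j; rewrite permM mulmxA; apply/eqmxP.
  have /eqmxP Va := Hs j; have /eqmxP Vb := Hs' (s j).
  exact: (eqmx_trans (eqmxMr _ Va) Vb).
Qed.

(* The translates of [W] by words leading [b] to the various blocks sum to an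
   invariant subspace, which is everything; [block_dim] then leaves no room for
   the sum not to be direct. *)
Lemma primitive_no_block gs t (sigma : 'I_e -> 'S_t.+1) b :
    GLtuple gs -> acts_primitively (gen_group gs) -> ~ has_block gs sigma b.
Proof.
move=> gsU [[n_gt0 irr] nodec] [W [W0 rW invW]].
have irr_gen (U : 'M[F]_n) : (forall i, (U *m gs i <= U)%MS) -> U != 0 ->
    row_full U.
  move=> invU U0; case: (irr U) => // [|U_0]; last by rewrite U_0 eqxx in U0.
  exact: gen_group_invariant.
have rW_gt0 : (0 < \rank W)%N by rewrite lt0n mxrank_eq0.
(* With one block every word fixes [b], so [W] is invariant of dimension at most [n.-1], against
   irreducibility. *)
case: t => [|t] in sigma b rW invW *.
  have : row_full W.
    apply: irr_gen W0 => i; have := invW [:: i]; rewrite /= mulmx1; apply.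
    exact: etrans (ord1 _) (esym (ord1 _)).
  rewrite /row_full => /eqP rWn; move: rW; rewrite /block_dim /= rWn.
  by rewrite leqNgt ltn_predL n_gt0.
rewrite /block_dim /= in rW.
(* A translate of [W] depends only on the block reached: a word [v] leading back to [b] brings both
   translates to [W]. *)
have coset w w' : word_act sigma w b = word_act sigma w' b ->
    (W *m word gs w == W *m word gs w')%MS.
  move=> eq_ww'; have [v vb] := word_act_return sigma w b.
  have vU := word_unit v gsU.
  have close u : word_act sigma u b = word_act sigma w b ->
      (W *m word gs u *m word gs v :=: W)%MS.
    move=> eq_u; apply/eqmxP; rewrite -mulmxA -word_cat.
    apply: submx_unit_eqmx => //; first exact: word_unit.
    by apply: invW; rewrite word_act_cat eq_u.
  have E := eqmx_trans (close w erefl) (eqmx_sym (close w' (esym eq_ww'))).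
  apply/eqmxP; have := eqmxMr (invmx (word gs v)) E.
  by rewrite !mulmxK.
(* The empty word is a default for blocks not reachable from [b]; [Puj] excludes these later. *)
have /fin_all_exists [u Pu] j : exists w, word_act sigma w b = j \/
    w = [::] /\ forall w', word_act sigma w' b <> j.
  have [[w wj]|now] := classic (exists w, word_act sigma w b = j).
    by exists w; left.
  by exists [::]; right; split=> // w wj; apply: now; exists w.
pose V j := W *m word gs (u j).
have rV j : \rank (V j) = \rank W.
  by rewrite mxrankMfree // row_free_unit word_unit.
have actV w i : (W *m word gs w *m gs i == V (sigma i (word_act sigma w b)))%MS.
  have -> : W *m word gs w *m gs i = W *m word gs (w ++ [:: i]).
    by rewrite word_cat /= mulmx1 mulmxA.
  apply: coset; rewrite word_act_cat /=.
  case: (Pu (sigma i (word_act sigma w b))) => [->//|[_ /(_ (w ++ [:: i]))]].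
  by rewrite word_act_cat.
have fullV : row_full (\sum_j V j)%MS.
  rewrite -[row_full _]/(_ == _) -mxrank_gen; apply: irr_gen.
    move=> i; rewrite (eqmxMr _ (genmxE _)) genmxE sumsmxMr.
    apply/sumsmx_subP => j _; have /andP[le_j _] := actV (u j) i.
    by apply: submx_trans le_j _; apply: (sumsmx_sup _ _ (submx_refl _)).
  rewrite -mxrank_eq0 mxrank_gen mxrank_eq0; apply: contraTneq rW_gt0 => V0.
  by rewrite -(rV b) -leqNgt leqn0 mxrank_eq0 -submx0 -V0 (sumsmx_sup b).
have dirV : mxdirect (\sum_j V j)%MS.
  rewrite mxdirectEgeq /= (eqP fullV) (eq_bigr _ (fun j _ => rV j)).
  rewrite sum_nat_const card_ord; apply: leq_trans (leq_trunc_div n t.+2).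
  by rewrite mulnC leq_mul2r rW orbT.
have Vneq0 j : V j != 0 by rewrite -mxrank_eq0 rV mxrank_eq0.
(* For an unreachable [j], the default makes [V j] and [V b] the same nonzero subspace, which a
   direct sum forbids. *)
have Puj j : word_act sigma (u j) b = j.
  case: (Pu j) => // -[uj noj]; have jb : b != j.
    by apply/eqP => bj; apply: (noj [::]).
  have /mxdirect_sumsP /(_ j isT) /eqP := dirV.
  rewrite -submx0 => cap0; case/negP: (Vneq0 j).
  rewrite -submx0; apply: submx_trans cap0; rewrite sub_capmx submx_refl.
  apply: (sumsmx_sup b) => //.
  have /andP[] // : (V j == V b)%MS.
  rewrite /V uj; apply: coset; case: (Pu b) => [->//|[_ /(_ [::])]].
  by case.
apply: nodec; exists t.+2, V; split=> //.
apply: (gen_group_permutes (sigma := sigma)) => // i j.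
by have := actV (u j) i; rewrite Puj.
Qed.

(** A reducible group has a nonzero proper invariant subspace, used with [t = 0]. Otherwise [sigma]
    is the action of the generators on a preserved decomposition, and [W] is a summand of least
    dimension. *)
Lemma not_primitive_block gs : (0 < n)%N -> GLtuple gs ->
    ~ acts_primitively (gen_group gs) ->
  exists t (sigma : 'I_e -> 'S_t.+1) b, (t < n)%N /\ has_block gs sigma b.
Proof.
move=> n_gt0 gsU notprim.
have word_gen w : gen_group gs (word gs w).
  elim: w => [|i w IHw]; first exact: gen_one.
  by apply: gen_mul => //; apply: gen_gen.
have [irr|nirr] := classic (Defs.acts_irreducibly (gen_group gs)); last first.
  exists 0%N, (fun=> 1%g), ord0; split=> //; apply: NNPP => nblock.
  apply: nirr; split=> // U invU; have [->|U0] := eqVneq U 0; [by left|right].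
  rewrite /row_full eqn_leq rank_leq_col leqNgt; apply/negP => ltU.
  apply: nblock; exists U; split=> // [|w _]; last exact: invU.
  by rewrite /block_dim /= -ltnS prednK.
have [[|[|t]] [Vs [// _ Vs0 dirV fullV permV]]] :
  preserves_decomposition (gen_group gs) by apply: NNPP => nodec; apply: notprim.
have /fin_all_exists [sigma Hs] i := permV _ (gen_gen gs i).
have sumr : (\sum_j \rank (Vs j) = n)%N.
  by rewrite -(mxdirectP dirV) /= (eqP fullV).
(* The smallest of [t.+2] summands has dimension at most [n %/ t.+2]. *)
have [j0 _ minj] := @arg_minnP _ ord0 xpredT (fun j => \rank (Vs j)) isT.
exists t.+1, sigma, j0; split.
  rewrite -sumr; apply: (@leq_trans (\sum_(j < t.+2) 1)%N).
    by rewrite sum_nat_const card_ord muln1.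
  by apply: leq_sum => j _; rewrite lt0n mxrank_eq0.
exists (Vs j0); split=> // [|w wj0].
  rewrite /block_dim /= leq_divRL // -[leqRHS]sumr.
  apply: (@leq_trans (\sum_(j < t.+2) \rank (Vs j0))%N).
    by rewrite sum_nat_const card_ord mulnC.
  by apply: leq_sum => j _; apply: minj.
suff wE j : (Vs j *m word gs w :=: Vs (word_act sigma w j))%MS.
  by rewrite wE wj0.
elim: w j {wj0} => [|i w IHw] j /=; first by rewrite mulmx1.
have /eqmxP E := Hs i j; rewrite mulmxA.
exact: eqmx_trans (eqmxMr _ E) (IHw _).
Qed.

End Words.

(** * Evaluation of the free algebra at a tuple *)

Section FreeAlgebra.
Variables (F : fieldType) (n e : nat).
Implicit Types (gs : 'I_e -> 'M[F]_n) (l : seq (F * seq 'I_e)).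

(* [l] is an element of the free algebra on ['I_e], listed as monomials. *)
Definition eval_free gs l : 'M[F]_n := \sum_(cw <- l) cw.1 *: word gs cw.2.

Variable S : pred (seq 'I_e).
Hypothesis S1 : S [::].
Hypothesis SM : forall w w', S w -> S w' -> S (w ++ w').

Definition supported l : bool := all (fun cw => S cw.2) l.

(** The list [l] does not involve [gs], so the same element can later be evaluated at other
    tuples. *)
Definition word_span gs (a : 'M[F]_n) : Prop :=
  exists l, supported l /\ a = eval_free gs l.

Lemma word_span_word gs w : S w -> word_span gs (word gs w).
Proof.
move=> Sw; exists [:: (1, w)]; split; first by rewrite /supported /= Sw.
by rewrite /eval_free big_seq1 scale1r.
Qed.

Lemma word_span1 gs : word_span gs 1%:M.
Proof. exact: (word_span_word gs S1). Qed.

Lemma word_spanD gs a b : word_span gs a -> word_span gs b -> word_span gs (a + b).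
Proof.
move=> [l [Sl ->]] [l' [Sl' ->]]; exists (l ++ l').
by rewrite /supported all_cat; split; [apply/andP | rewrite /eval_free big_cat].
Qed.

Lemma word_spanZ gs c a : word_span gs a -> word_span gs (c *: a).
Proof.
move=> [l [Sl ->]]; exists [seq (c * cw.1, cw.2) | cw <- l].
rewrite /supported all_map; split=> //.
by rewrite /eval_free big_map scaler_sumr; apply: eq_bigr => cw _; rewrite scalerA.
Qed.

Lemma word_spanM gs a b : word_span gs a -> word_span gs b -> word_span gs (a *m b).
Proof.
move=> [l [Sl ->]] [l' [Sl' ->]].
exists [seq (cw.1 * cw'.1, cw.2 ++ cw'.2) | cw <- l, cw' <- l']; split.
  apply/allP => _ /allpairsP [[cw cw'] /= [lcw lcw' ->]] /=.
  by apply: SM; [apply: (allP Sl) | apply: (allP Sl')].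
rewrite /eval_free big_allpairs_dep mulmx_suml; apply: eq_bigr => cw _ /=.
rewrite mulmx_sumr; apply: eq_bigr => cw' _ /=.
by rewrite word_cat -scalemxAl -scalemxAr scalerA.
Qed.

Lemma word_span_invariant gs (W : 'M[F]_n) :
  (forall w, S w -> (W *m word gs w <= W)%MS) ->
  forall a, word_span gs a -> (W *m a <= W)%MS.
Proof.
move=> invW _ [l [Sl ->]]; rewrite mulmx_sumr big_seq; apply: summx_sub => cw lcw.
by rewrite -scalemxAr scalemx_sub // invW // (allP Sl).
Qed.

End FreeAlgebra.

(** * Polynomial functions of a tuple of matrices *)

Section PolynomialFunctions.
Variables (F : fieldType) (n e : nat).

Definition poly_fun (f : ('I_e -> 'M[F]_n) -> F) : Prop :=
  exists p : {mpoly F[e * (n * n)]}, forall gs, p.@[tuple_coords gs] = f gs.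

Lemma poly_fun_const c : poly_fun (fun _ => c).
Proof. by exists c%:MP => gs; rewrite mevalC. Qed.

Lemma poly_funM f g : poly_fun f -> poly_fun g -> poly_fun (fun gs => f gs * g gs).
Proof. by move=> [p Hp] [q Hq]; exists (p * q) => gs; rewrite mevalM Hp Hq. Qed.

Lemma poly_fun_sum (I : Type) (r : seq I) (P : pred I) f :
  (forall i, poly_fun (f i)) -> poly_fun (fun gs => \sum_(i <- r | P i) f i gs).
Proof.
move=> pf; elim: r => [|i r [p Hp]].
  by have [p Hp] := poly_fun_const 0; exists p => gs; rewrite Hp big_nil.
have [q Hq] := pf i; exists (if P i then q + p else p) => gs; rewrite big_cons.
by case: ifP; rewrite ?mevalD ?Hp ?Hq.
Qed.

Lemma poly_fun_prod (I : Type) (r : seq I) (P : pred I) f :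
  (forall i, poly_fun (f i)) -> poly_fun (fun gs => \prod_(i <- r | P i) f i gs).
Proof.
move=> pf; elim: r => [|i r [p Hp]].
  by have [p Hp] := poly_fun_const 1; exists p => gs; rewrite Hp big_nil.
have [q Hq] := pf i; exists (if P i then q * p else p) => gs; rewrite big_cons.
by case: ifP; rewrite ?mevalM ?Hp ?Hq.
Qed.

Definition poly_mx k l (f : ('I_e -> 'M[F]_n) -> 'M[F]_(k, l)) : Prop :=
  forall i j, poly_fun (fun gs => f gs i j).

Lemma poly_fun_ext f g : f =1 g -> poly_fun f -> poly_fun g.
Proof. by move=> fg [p Hp]; exists p => gs; rewrite Hp fg. Qed.

Lemma poly_mx_const k l (M : 'M[F]_(k, l)) : poly_mx (fun _ => M).
Proof. by move=> i j; apply: poly_fun_const. Qed.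

Lemma poly_mx_gen i : poly_mx (fun gs => gs i).
Proof.
move=> a b; exists 'X_(mxvec_index i (mxvec_index a b)) => gs.
by rewrite mevalXU /tuple_coords mxvecE mxE mxvecE.
Qed.

Lemma poly_mx_sum (I : Type) (r : seq I) k l
    (f : I -> ('I_e -> 'M[F]_n) -> 'M[F]_(k, l)) :
  (forall i, poly_mx (f i)) -> poly_mx (fun gs => \sum_(i <- r) f i gs).
Proof.
move=> pf a b; apply: poly_fun_ext (fun gs => esym (summxE r xpredT _ a b)) _.
by apply: poly_fun_sum => i; apply: pf.
Qed.

Lemma poly_mxZ k l c (f : ('I_e -> 'M[F]_n) -> 'M[F]_(k, l)) :
  poly_mx f -> poly_mx (fun gs => c *: f gs).
Proof.
move=> pf a b.
apply: (@poly_fun_ext (fun gs => c * f gs a b)) => [gs|]; first by rewrite mxE.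
by apply: poly_funM => //; apply: poly_fun_const.
Qed.

Lemma poly_mxM k l m (f : ('I_e -> 'M[F]_n) -> 'M[F]_(k, l)) g :
  poly_mx f -> poly_mx g -> poly_mx (fun gs => f gs *m (g gs : 'M[F]_(l, m))).
Proof.
move=> pf pg a b; apply: (@poly_fun_ext (fun gs => \sum_j f gs a j * g gs j b)).
  by move=> gs; rewrite mxE.
by apply: poly_fun_sum => j; apply: poly_funM.
Qed.

Lemma poly_mx_prod (I : Type) (r : seq I) k
    (f : I -> ('I_e -> 'M[F]_n) -> 'M[F]_k) :
  (forall i, poly_mx (f i)) -> poly_mx (fun gs => \prod_(i <- r) f i gs).
Proof.
move=> pf; elim: r => [|i r IHr] a b.
  apply: (poly_fun_ext (f := fun _ => (1 : 'M[F]_k) a b)) => [gs|].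
    by rewrite big_nil.
  exact: poly_fun_const.
apply: poly_fun_ext (poly_mxM (pf i) IHr a b) => gs.
by rewrite big_cons.
Qed.

Lemma poly_fun_det k (f : ('I_e -> 'M[F]_n) -> 'M[F]_k) :
  poly_mx f -> poly_fun (fun gs => \det (f gs)).
Proof.
move=> pf; apply: poly_fun_sum => s; apply: poly_funM; first exact: poly_fun_const.
by apply: poly_fun_prod => i; apply: pf.
Qed.

Lemma poly_mx_word w : poly_mx (fun gs => word gs w).
Proof.
elim: w => [|i w IHw] /=; first exact: poly_mx_const.
exact: poly_mxM (poly_mx_gen i) IHw.
Qed.

Lemma poly_mx_eval_free l : poly_mx (fun gs => eval_free gs l).
Proof. by apply: poly_mx_sum => cw; apply: poly_mxZ; apply: poly_mx_word. Qed.

Lemma poly_mx_capelli m (y x y' : 'I_m -> ('I_e -> 'M[F]_n) -> 'M[F]_n) :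
    (forall i, poly_mx (y i)) -> (forall i, poly_mx (x i)) ->
    (forall i, poly_mx (y' i)) ->
  poly_mx (fun gs => capelli (y^~ gs) (x^~ gs) (y'^~ gs)).
Proof.
move=> py px py'; apply: poly_mx_sum => s; apply: poly_mxZ.
by apply: poly_mx_prod => i; do 2!apply: poly_mxM => //.
Qed.

End PolynomialFunctions.

(** * Separating functions and openness *)

(** Without a block at [gs0], no nonzero vector is killed by all products [cap gs0 z], so some minor
    made of their columns is nonzero. As a function of the tuple, this minor vanishes wherever a
    block exists. *)
Lemma separating_poly_fun (F : closedFieldType) (n e t : nat)
    (sigma : 'I_e -> 'S_t.+1) (b : 'I_t.+1) (gs0 : 'I_e -> 'M[F]_n) :
    ~ has_block gs0 sigma b ->
  exists f, [/\ poly_fun f, f gs0 != 0 &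
    forall gs : 'I_e -> 'M[F]_n, has_block gs sigma b -> f gs = 0].
Proof.
move=> noblock; pose S w := word_act sigma w b == b.
have S1 : S [::] by rewrite /S.
have SM w w' : S w -> S w' -> S (w ++ w').
  by rewrite /S word_act_cat => /eqP ->.
pose m := (block_dim n t * block_dim n t).+1.
pose L := seq (F * seq 'I_e).
pose cap gs (z : L * (('I_m -> L) * ('I_m -> L) * ('I_m -> L))) : 'M[F]_n :=
  eval_free gs z.1 *m capelli (fun i => eval_free gs (z.2.1.1 i))
    (fun i => eval_free gs (z.2.1.2 i)) (fun i => eval_free gs (z.2.2 i)).
pose good (z : L * (('I_m -> L) * ('I_m -> L) * ('I_m -> L))) : Prop :=
  supported S z.1 /\ forall i, [/\ supported S (z.2.1.1 i),
    supported S (z.2.1.2 i) & supported S (z.2.2 i)].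
pose Cap gs C := exists z, good z /\ C = cap gs z.
have [v|C [c [CapC detC]]] := @nonzero_minor _ _ (Cap gs0).
  move=> killed; apply/eqP/negP => /negP v0; apply: noblock.
  have [a y x y' [la [Sla ->]]|W [W0 rW invW]] := capelli_submodule
    (word_span1 S1 gs0) (@word_spanD _ _ _ S gs0) (@word_spanZ _ _ _ S gs0)
    (@word_spanM _ _ _ _ SM gs0) v0 (d := block_dim n t).
    move=> /fin_all_exists [ly Hy] /fin_all_exists [lx Hx] /fin_all_exists [ly' Hy'].
    apply: killed; exists (la, (ly, lx, ly')); split.
      split=> // i; split; [by case: (Hy i) | by case: (Hx i) | by case: (Hy' i)].
    congr (_ *m _); apply: eq_bigr => s _; congr (_ *: _); apply: eq_bigr => i _.
    by case: (Hy i) (Hx (s i)) (Hy' i) => _ -> [_ ->] [_ ->].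
  exists W; split=> // w wb; apply: invW; apply: word_span_word.
  by rewrite /S wb.
have /fin_all_exists [z Hz] i := CapC i.
(* The elements [z i] and the columns [c i] found at [gs0] are kept while [gs] varies. *)
exists (fun gs => \det (\matrix_(i, j) cap gs (z i) j (c i))); split.
- apply: poly_fun_det => i j.
  apply: (poly_fun_ext (f := fun gs => cap gs (z i) j (c i))).
    by move=> gs; rewrite [RHS]mxE.
  apply: poly_mxM; first exact: poly_mx_eval_free.
  by apply: poly_mx_capelli => k; apply: poly_mx_eval_free.
- congr (\det _ != 0): detC; apply/matrixP => i j.
  by rewrite [LHS]mxE [RHS]mxE; case: (Hz i) => _ ->.
move=> gs [W [W0 rW invW]].
have /rowV0Pn [v vW v0] := W0.
(* A nonzero [v] in [W] is orthogonal to every chosen column, so the transposed matrix is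
   singular. *)
rewrite -det_tr; apply/eqP/det0P; exists v => //; apply/rowP => i.
have invS : stable_by (word_span S gs) W.
  by apply: word_span_invariant => w /eqP; apply: invW.
have [[Sa Syxy] _] := Hz i.
have : v *m cap gs (z i) = 0.
  have /submxP [D ->] := vW; rewrite -mulmxA.
  rewrite (@submodule_capelli _ _ (word_span S gs) _ W _ _ _ _ invS rW) ?mulmx0 //.
  - by exists (z i).1.
  - by move=> k; exists ((z i).2.1.1 k); case: (Syxy k).
  - by move=> k; exists ((z i).2.1.2 k); case: (Syxy k).
  - by move=> k; exists ((z i).2.2 k); case: (Syxy k).
move=> /rowP /(_ (c i)); rewrite [RHS]mxE => vc0.
rewrite [RHS]mxE -[RHS]vc0 [LHS]mxE [RHS]mxE.
by apply: eq_bigr => j _; congr (_ * _); rewrite [LHS]mxE [LHS]mxE.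
Qed.

Theorem theorem2p9 (F : closedFieldType) (n e : nat) :
  (0 < n)%N -> (1 <= e)%N ->
  zariski_open_in_GLtuple
    (fun gs : 'I_e -> 'M[F]_n => GLtuple gs /\ acts_primitively (gen_group gs)).
Proof.
move=> n_gt0 _; split=> [gs []//|].
(* Taking all polynomials that vanish on the non-primitive tuples, it remains to find one that is
   nonzero at a given primitive [gs0]. *)
exists (fun p => forall gs : 'I_e -> 'M[F]_n, GLtuple gs ->
  ~ acts_primitively (gen_group gs) -> p.@[tuple_coords gs] = 0).
move=> gs0 gs0U; split=> [nprim p|vanish [_ prim]].
  by apply=> // prim; apply: nprim.
(* Encoding the actions as finite functions, with [t < n], makes the index type finite, so a product
   over it is available. *)
pose idx := {t : 'I_n & ({ffun 'I_e -> 'S_t.+1} * 'I_t.+1)%type}.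
have /fin_all_exists [f Hf] (k : idx) : exists f, [/\ poly_fun f, f gs0 != 0 &
    forall gs : 'I_e -> 'M[F]_n,
      has_block gs (tagged k).1 (tagged k).2 -> f gs = 0].
  by apply: separating_poly_fun; apply: primitive_no_block.
(* The product of all [f k] is nonzero at [gs0]; at a non-primitive tuple the factor indexed by its
   block vanishes. *)
have [k|p Hp] := @poly_fun_prod F n e _ (index_enum idx) xpredT f; first by case: (Hf k).
have : p.@[tuple_coords gs0] = 0.
  apply: vanish => gs gsU nprim.
  have [t [sigma [b [lt_tn blk]]]] := not_primitive_block n_gt0 gsU nprim.
  pose k : idx := Tagged (fun t : 'I_n => ({ffun 'I_e -> 'S_t.+1} * 'I_t.+1)%type)
    (i := Ordinal lt_tn) ([ffun i => sigma i], b).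
  rewrite Hp (bigD1 k) //=; have [_ _ ->] := Hf k; first by rewrite mul0r.
  have [W [W0 rW invW]] := blk; exists W; split=> // w wb; apply: invW.
  rewrite -[RHS]wb /=; elim: w (b) {wb} => //= i w IHw b'.
  by rewrite ffunE; apply: IHw.
rewrite Hp => /eqP; apply/negP/prodf_neq0 => k _; by case: (Hf k).
Qed.
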